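(* Let $x\in\mathbb{R}$ be irrational. Then the set $\Gamma(x)=\{\gamma_1,\gamma_2,\gamma_3,\ldots\}\subset\Gamma$ equals $W\setminus(W_1\cup W_2)$, where $$W=\{\gamma\in\Gamma \mid -1\leq\gamma(\infty)\leq0,\ \gamma(x)>1\},$$ $$W_1=\{\gamma\in W\mid \gamma(\infty)=0,\ \det(\gamma)=1\},\qquad W_2=\{\gamma\in W\mid \gamma(\infty)=-1,\ \det(\gamma)=-1\}.$$ Moreover, $W_1$ has exactly one element and $W_2$ has at most one element.
   Context: $\Gamma=\mathrm{PGL}_2(\mathbb{Z})$ acts on $\mathbb{P}^1(\mathbb{R})=\mathbb{R}\cup\{\infty\}$ by $\begin{pmatrix}a&b\\c&d\end{pmatrix}x=\frac{ax+b}{cx+d}$; the determinant $\det(\gamma)\in\{\pm1\}$ is well defined on $\Gamma$. Let $\varepsilon=\begin{pmatrix}0&1\\1&0\end{pmatrix}$ and $T=\begin{pmatrix}1&1\\0&1\end{pmatrix}$. For irrational $x$, its classic continued fraction $x=[n_0,n_1,\ldots]$ ($n_0\in\mathbb{Z}$, $n_i\geq1$ for $i\geq1$) is produced by $x_0=x$, $n_i=\lfloor x_i\rfloor$, $x_{i+1}=\frac{1}{x_i-n_i}=\varepsilon T^{-n_i}(x_i)$ for $i\geq0$. Define $\gamma_0=\mathrm{Id}$ and $\gamma_{i+1}=\varepsilon T^{-n_i}\gamma_i$ for $i\geq0$, i.e. $\gamma_i=\begin{pmatrix}0&1\\1&-n_{i-1}\end{pmatrix}\cdots\begin{pmatrix}0&1\\1&-n_0\end{pmatrix}$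 for $i\geq1$, so that $x_i=\gamma_i(x)$. Set $\Gamma(x)=\{\gamma_1,\gamma_2,\gamma_3,\ldots\}$ (as an unordered set). The conditions $-1\leq\gamma(\infty)\leq0$ in particular require $\gamma(\infty)\neq\infty$. *)

(* Defs.v *)
From HB Require Import structures.
From mathcomp Require Import all_boot all_order all_algebra.
From mathcomp Require Import generic_quotient.
From mathcomp Require Import all_classical all_reals.

Set Implicit Arguments.
Unset Strict Implicit.
Unset Printing Implicit Defensive.

Import Order.TTheory GRing.Theory Num.Theory.

Local Open Scope quotient_scope.
Local Open Scope classical_set_scope.
Local Open Scope ring_scope.

Record GL2Z := MkGL2Z { GL2Z_mx : 'M[int]_2; _ : GL2Z_mx \in unitmx }.

HB.instance Definition _ := [isSub for GL2Z_mx].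
HB.instance Definition _ := [Choice of GL2Z by <:].

Section GL2Z.
Implicit Types A B : GL2Z.

Definition GL2Z_one : GL2Z := MkGL2Z (unitmx1 _ _).

Lemma GL2Z_inv_proof A : invmx (val A) \in unitmx.
Proof. by rewrite unitmx_inv (valP A). Qed.

Lemma GL2Z_mul_proof A B : val A *m val B \in unitmx.
Proof. by rewrite unitmx_mul (valP A) (valP B). Qed.

Lemma GL2Z_opp_proof A : - val A \in unitmx.
Proof. by have := valP A; rewrite -[in X in X -> _]unitrN. Qed.

Definition GL2Z_inv A : GL2Z := MkGL2Z (GL2Z_inv_proof A).
Definition GL2Z_mul A B : GL2Z := MkGL2Z (GL2Z_mul_proof A B).
Definition GL2Z_opp A : GL2Z := MkGL2Z (GL2Z_opp_proof A).

Lemma GL2Z_mulA : associative GL2Z_mul.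
Proof. by move=> A B C; apply/val_inj; rewrite /= mulmxA. Qed.

Lemma GL2Z_mul1 : left_id GL2Z_one GL2Z_mul.
Proof. by move=> A; apply/val_inj; rewrite /= mul1mx. Qed.

Lemma GL2Z_mulr1 : right_id GL2Z_one GL2Z_mul.
Proof. by move=> A; apply/val_inj; rewrite /= mulmx1. Qed.

Lemma GL2Z_mulV : left_inverse GL2Z_one GL2Z_inv GL2Z_mul.
Proof. by move=> A; apply/val_inj; rewrite /= mulVmx ?(valP A). Qed.

Lemma GL2Z_mulrV : right_inverse GL2Z_one GL2Z_inv GL2Z_mul.
Proof. by move=> A; apply/val_inj; rewrite /= mulmxV ?(valP A). Qed.

HB.instance Definition _ :=
  isGroup.Build GL2Z GL2Z_mulA GL2Z_mul1 GL2Z_mulr1 GL2Z_mulV GL2Z_mulrV.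

Definition GL2Z_eqpm A B := (A == B) || (A == GL2Z_opp B).

Lemma GL2Z_oppK : involutive GL2Z_opp.
Proof. by move=> A; apply/val_inj; rewrite /= opprK. Qed.

Lemma GL2Z_eqpm_refl : reflexive GL2Z_eqpm.
Proof. by move=> A; rewrite /GL2Z_eqpm eqxx. Qed.

Lemma GL2Z_eqpm_sym : symmetric GL2Z_eqpm.
Proof.
move=> A B; rewrite /GL2Z_eqpm !(eq_sym B).
by rewrite (can2_eq GL2Z_oppK GL2Z_oppK).
Qed.

Lemma GL2Z_eqpm_trans : transitive GL2Z_eqpm.
Proof.
move=> B A C /orP[]/eqP-> /orP[]/eqP->; 
by rewrite /GL2Z_eqpm ?GL2Z_oppK eqxx ?orbT.
Qed.

Canonical GL2Z_eqpm_equiv :=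
  EquivRel GL2Z_eqpm GL2Z_eqpm_refl GL2Z_eqpm_sym GL2Z_eqpm_trans.

End GL2Z.

Definition PGL2Z := {eq_quot GL2Z_eqpm}.

HB.instance Definition _ := Choice.on PGL2Z.
HB.instance Definition _ := EqQuotient.on PGL2Z.

Section PGL2Z.
Implicit Types A B : GL2Z.

Lemma PGL2Z_pi_opp A : \pi_PGL2Z (GL2Z_opp A) = \pi_PGL2Z A.
Proof. by apply/eqmodP; rewrite /= /GL2Z_eqpm eqxx orbT. Qed.

Lemma PGL2Z_pi_ind (T : Type) (f : GL2Z -> T) :
  (forall A, f (GL2Z_opp A) = f A) ->
  forall A, f (repr (\pi_PGL2Z A)) = f A.
Proof.
move=> fN A; have /eqmodP := reprK (\pi_PGL2Z A).
by move=> /orP[]/eqP->.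
Qed.

Lemma GL2Z_mulN A B : GL2Z_mul A (GL2Z_opp B) = GL2Z_opp (GL2Z_mul A B).
Proof. by apply/val_inj; rewrite /= mulmxN. Qed.

Lemma GL2Z_mulNl A B : GL2Z_mul (GL2Z_opp A) B = GL2Z_opp (GL2Z_mul A B).
Proof. by apply/val_inj; rewrite /= mulNmx. Qed.

Lemma GL2Z_invN A : GL2Z_inv (GL2Z_opp A) = GL2Z_opp (GL2Z_inv A).
Proof. by apply/val_inj; exact: (invrN (val A)). Qed.

Definition PGL2Z_one : PGL2Z := \pi_PGL2Z GL2Z_one.
Definition PGL2Z_inv (g : PGL2Z) : PGL2Z := \pi_PGL2Z (GL2Z_inv (repr g)).
Definition PGL2Z_mul (g h : PGL2Z) : PGL2Z := \pi_PGL2Z (GL2Z_mul (repr g) (repr h)).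

Lemma PGL2Z_pi_mul A B :
  PGL2Z_mul (\pi_PGL2Z A) (\pi_PGL2Z B) = \pi_PGL2Z (GL2Z_mul A B).
Proof.
rewrite /PGL2Z_mul (PGL2Z_pi_ind
  (f := fun C => \pi_PGL2Z (GL2Z_mul C (repr (\pi_PGL2Z B))))) => [|C].
  rewrite (PGL2Z_pi_ind (f := fun C => \pi_PGL2Z (GL2Z_mul A C))) // => C.
  by rewrite GL2Z_mulN PGL2Z_pi_opp.
by rewrite GL2Z_mulNl PGL2Z_pi_opp.
Qed.

Lemma PGL2Z_pi_inv A : PGL2Z_inv (\pi_PGL2Z A) = \pi_PGL2Z (GL2Z_inv A).
Proof.
rewrite /PGL2Z_inv (PGL2Z_pi_ind (f := fun C => \pi_PGL2Z (GL2Z_inv C))) // => C.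
by rewrite GL2Z_invN PGL2Z_pi_opp.
Qed.

Lemma PGL2Z_mulA : associative PGL2Z_mul.
Proof.
elim/quotW=> A; elim/quotW=> B; elim/quotW=> C.
by rewrite (PGL2Z_pi_mul B) (PGL2Z_pi_mul A B) !PGL2Z_pi_mul GL2Z_mulA.
Qed.

Lemma PGL2Z_mul1 : left_id PGL2Z_one PGL2Z_mul.
Proof.
by elim/quotW=> A; rewrite PGL2Z_pi_mul GL2Z_mul1.
Qed.

Lemma PGL2Z_mulr1 : right_id PGL2Z_one PGL2Z_mul.
Proof.
by elim/quotW=> A; rewrite PGL2Z_pi_mul GL2Z_mulr1.
Qed.

Lemma PGL2Z_mulV : left_inverse PGL2Z_one PGL2Z_inv PGL2Z_mul.
Proof.
by elim/quotW=> A; rewrite (PGL2Z_pi_inv A) PGL2Z_pi_mul GL2Z_mulV.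
Qed.

Lemma PGL2Z_mulrV : right_inverse PGL2Z_one PGL2Z_inv PGL2Z_mul.
Proof.
by elim/quotW=> A; rewrite (PGL2Z_pi_inv A) PGL2Z_pi_mul GL2Z_mulrV.
Qed.

HB.instance Definition _ := isGroup.Build PGL2Z
  PGL2Z_mulA PGL2Z_mul1 PGL2Z_mulr1 PGL2Z_mulV PGL2Z_mulrV.

Lemma PGL2Z_piM A B : \pi_PGL2Z (A * B)%g = (\pi_PGL2Z A * \pi_PGL2Z B)%g.
Proof. exact/esym/PGL2Z_pi_mul. Qed.

Definition PGL2Z_det (g : PGL2Z) : int := \det (val (repr g)).

Lemma PGL2Z_detE A : PGL2Z_det (\pi_PGL2Z A) = \det (val A).
Proof.
rewrite /PGL2Z_det (PGL2Z_pi_ind (f := fun C => \det (val C))) // => C.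
by rewrite /= -scaleN1r detZ sqrrN expr1n mul1r.
Qed.

End PGL2Z.

Section Action.
Variable R : realType.

Definition P1 : Type := option R.
Definition infty : P1 := None.

Definition mobius (A : 'M[int]_2) (p : P1) : P1 :=
  let a := (A 0 0)%:~R : R in let b := (A 0 1)%:~R : R in
  let c := (A 1 0)%:~R : R in let d := (A 1 1)%:~R : R in
  if p is Some y then
    if c * y + d == 0 then infty else Some ((a * y + b) / (c * y + d))
  else if c == 0 then infty else Some (a / c).

Definition act (g : PGL2Z) (p : P1) : P1 := mobius (val (repr g)) p.

Lemma mobiusN (A : 'M[int]_2) (p : P1) : mobius (- A) p = mobius A p.
Proof.
rewrite /mobius !mxE !rmorphN /=; case: p => [y|].
  by rewrite !mulNr -!opprD oppr_eq0 invrN mulrNN.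
by rewrite oppr_eq0 invrN mulrNN.
Qed.

Lemma actE (A : GL2Z) (p : P1) : act (\pi_PGL2Z A) p = mobius (val A) p.
Proof.
rewrite /act (PGL2Z_pi_ind (f := fun C => mobius (val C) p)) // => C.
exact: mobiusN.
Qed.

End Action.

Arguments infty {R}.

Definition mx22 (a b c d : int) : 'M[int]_2 :=
  \matrix_(i, j) if i == 0 then (if j == 0 then a else b)
                 else (if j == 0 then c else d).

Lemma det_mx22 a b c d : \det (mx22 a b c d) = a * d - b * c.
Proof.
rewrite (expand_det_row _ 0) !big_ord_recl big_ord0 /cofactor !det_mx11 !mxE /=.
by rewrite !mul1r expr1 mulN1r addr0 mulrN.
Qed.

Lemma eps_proof : mx22 0 1 1 0 \in unitmx.
Proof. by rewrite unitmxE det_mx22. Qed.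

Lemma T_proof : mx22 1 1 0 1 \in unitmx.
Proof. by rewrite unitmxE det_mx22. Qed.

Definition eps : PGL2Z := \pi_PGL2Z (MkGL2Z eps_proof).
Definition T : PGL2Z := \pi_PGL2Z (MkGL2Z T_proof).

Definition expgz (G : groupType) (g : G) (n : int) : G :=
  match n with Posz k => (g ^+ k)%g | Negz k => (g ^- k.+1)%g end.

Section ContinuedFraction.
Variables (R : realType) (x : R).

Fixpoint cf_tail (i : nat) : R :=
  if i is j.+1 then (cf_tail j - (Num.floor (cf_tail j))%:~R)^-1 else x.

Definition cf_digit (i : nat) : int := Num.floor (cf_tail i).

Fixpoint cf_gamma (i : nat) : PGL2Z :=
  if i is j.+1 then (eps * expgz T (- cf_digit j) * cf_gamma j)%g else 1%g.

Definition Gamma_set : set PGL2Z := [set cf_gamma i.+1 | i in [set: nat]].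

(* [Some r] in the first clause excludes g(infty) = infty; since x is irrational,
   g(x) is always finite in the second one. *)
Definition W : set PGL2Z :=
  [set g | (exists2 r : R, act g infty = Some r & -1 <= r <= 0) /\
           (exists2 s : R, act g (Some x) = Some s & 1 < s)].

Definition W1 : set PGL2Z :=
  [set g | [/\ W g, act g infty = Some (0 : R) & PGL2Z_det g = 1]].

Definition W2 : set PGL2Z :=
  [set g | [/\ W g, act g infty = Some (-1 : R) & PGL2Z_det g = -1]].

End ContinuedFraction.

(* Main.v *)
(* Inverting the recursion: if g = eps T^(-n) h, then h = T^n eps g, so that
   h(y) = n + 1 / g(y).  For g in W with g(oo) nonzero and a suitable n >= 1,
   this h is again in W with a smaller denominator of h(oo), and n is the next
   digit of x because h(x) = n + 1 / g(x) with g(x) > 1.  The descent stops at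
   g(oo) = 0, where g(y) = - det g / (y + n) with n determined by g(x) > 1:
   determinant -1 gives gamma_1 and determinant 1 the unique element of W1.
   For g in W2, taking n = 1 gives h in W1, so W2 has at most one element. *)

Require Import Defs.
From mathcomp Require Import all_boot all_order all_algebra.
From mathcomp Require Import all_classical all_reals.
From mathcomp Require Import generic_quotient.
From mathcomp Require Import zify ring lra.

Set Implicit Arguments.
Unset Strict Implicit.
Unset Printing Implicit Defensive.

Import Order.TTheory GRing.Theory Num.Theory.

Local Open Scope quotient_scope.
Local Open Scope ring_scope.
Local Open Scope classical_set_scope.

(** * Matrix representatives of elements of [PGL2Z] *)

Definition represents (a b c d : int) (g : PGL2Z) : Prop :=
  exists2 A : GL2Z, val A = mx22 a b c d & g = \pi_PGL2Z A.

Lemma mx22_eta (A : 'M[int]_2) : A = mx22 (A 0 0) (A 0 1) (A 1 0) (A 1 1).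
Proof.
apply/matrixP => i j; rewrite mxE.
by case: i j => [[|[]]//= ?] [[|[]]//= ?]; congr (A _ _); apply/val_inj.
Qed.

Lemma mulmx22 a b c d a' b' c' d' :
  mx22 a b c d *m mx22 a' b' c' d' =
  mx22 (a * a' + b * c') (a * b' + b * d') (c * a' + d * c') (c * b' + d * d').
Proof.
rewrite [LHS]mx22_eta; congr mx22;
  by rewrite !mxE !big_ord_recl big_ord0 !mxE /= addr0.
Qed.

Lemma oppmx22 a b c d : - mx22 a b c d = mx22 (- a) (- b) (- c) (- d).
Proof. by rewrite [LHS]mx22_eta; congr mx22; rewrite !mxE. Qed.

Lemma represents_ex g : exists a b c d, represents a b c d g.
Proof.
exists (val (repr g) 0 0), (val (repr g) 0 1), (val (repr g) 1 0),
       (val (repr g) 1 1), (repr g); first exact: mx22_eta.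
by rewrite reprK.
Qed.

Lemma represents_mx22 a b c d :
  a * d - b * c \is a GRing.unit -> exists g, represents a b c d g.
Proof.
rewrite -det_mx22 -[_ \is a _]/(_ \in unitmx) => Au.
by exists (\pi_PGL2Z (MkGL2Z Au)), (MkGL2Z Au).
Qed.

Lemma represents_inj a b c d g h :
  represents a b c d g -> represents a b c d h -> g = h.
Proof.
move=> [A EA ->] [B EB ->]; congr (\pi_PGL2Z _).
by apply/val_inj; rewrite EA EB.
Qed.

(** Used to pass to the representative whose lower left entry is positive. *)
Lemma representsN a b c d g :
  represents a b c d g -> represents (- a) (- b) (- c) (- d) g.
Proof.
move=> [A EA ->]; exists (GL2Z_opp A); first by rewrite /= EA oppmx22.
by rewrite PGL2Z_pi_opp.
Qed.

Lemma represents_det a b c d g :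
  represents a b c d g -> a * d - b * c = PGL2Z_det g.
Proof. by move=> [A EA ->]; rewrite PGL2Z_detE EA det_mx22. Qed.

Lemma PGL2Z_det_sign (g : PGL2Z) : PGL2Z_det g = 1 \/ PGL2Z_det g = -1.
Proof.
have : PGL2Z_det g \is a GRing.unit := valP (repr g).
by case/orP => /eqP; [left | right].
Qed.

Lemma represents_mul a b c d a' b' c' d' g h :
  represents a b c d g -> represents a' b' c' d' h ->
  represents (a * a' + b * c') (a * b' + b * d')
             (c * a' + d * c') (c * b' + d * d') (g * h)%g.
Proof.
move=> [A EA ->] [B EB ->]; exists (A * B)%g; last by rewrite PGL2Z_piM.
by rewrite -mulmx22 -EA -EB.
Qed.

Lemma represents1 : represents 1 0 0 1 1%g.
Proof.
by exists GL2Z_one => //; apply/matrixP => i j; rewrite !mxE;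
  case: i j => [[|[]]//= ?] [[|[]]//= ?].
Qed.

Lemma represents_eps : represents 0 1 1 0 eps.
Proof. by exists (MkGL2Z eps_proof). Qed.

Lemma represents_T n : represents 1 n 0 1 (expgz T n).
Proof.
have TX k : represents 1 k%:Z 0 1 (T ^+ k)%g.
  elim: k => [|k IH]; first exact: represents1.
  have T1 : represents 1 1 0 1 T by exists (MkGL2Z T_proof).
  by rewrite expgS; move: (represents_mul T1 IH); congr represents; lia.
case: n => k /=; first exact: TX.
(* For a negative exponent, the expected inverse [h] is built from its matrix and then identified by
   multiplying with [T ^+ k.+1]. *)
have [|h hh] := @represents_mx22 1 (- k.+1%:Z) 0 1.
  by rewrite mulr1 mulr0 subr0.
suff <- : h = (T ^- k.+1)%g by rewrite NegzE.
apply: (mulIg (T ^+ k.+1)%g); rewrite mulVg.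
apply: represents_inj represents1.
by move: (represents_mul hh (TX k.+1)); congr represents; lia.
Qed.

(** * One step of the recursion and its inverse *)

Definition cf_step (n : int) (g : PGL2Z) : PGL2Z := (eps * expgz T (- n) * g)%g.

(** Inverse of [cf_step n], as [eps] is an involution. The parameter [n] is free because the descent
    chooses it before it is known to be a digit of [x]. *)
Definition cf_unstep (n : int) (g : PGL2Z) : PGL2Z := (expgz T n * eps * g)%g.

Lemma represents_step n a b c d g :
  represents a b c d g ->
  represents c d (a - n * c) (b - n * d) (cf_step n g).
Proof.
move=> /(represents_mul (represents_mul represents_eps (represents_T (- n)))).
by congr represents; ring.
Qed.

Lemma represents_unstep n a b c d g :
  represents a b c d g ->
  represents (c + n * a) (d + n * b) a b (cf_unstep n g).
Proof.
move=> /(represents_mul (represents_mul (represents_T n) represents_eps)).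
by congr represents; ring.
Qed.

Lemma cf_unstepK n : cancel (cf_unstep n) (cf_step n).
Proof.
move=> g; have [a [b [c [d hg]]]] := represents_ex g.
apply: represents_inj (hg).
by move: (represents_step n (represents_unstep n hg)); congr represents; ring.
Qed.

Lemma det_step n g : PGL2Z_det (cf_step n g) = - PGL2Z_det g.
Proof.
have [a [b [c [d hg]]]] := represents_ex g.
by rewrite -(represents_det hg) -(represents_det (represents_step n hg)); ring.
Qed.

Lemma det_unstep n g : PGL2Z_det (cf_unstep n g) = - PGL2Z_det g.
Proof. by rewrite -[in RHS](cf_unstepK n g) det_step opprK. Qed.

(** * Effect of a step on points of the projective line *)

Section Action.
Variable R : realType.
Implicit Types (x y : R) (p : P1 R).

Lemma represents_act_some a b c d g y : represents a b c d g ->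
  act g (Some y) = if c%:~R * y + d%:~R == 0 then infty
                   else Some ((a%:~R * y + b%:~R) / (c%:~R * y + d%:~R)).
Proof. by move=> [A EA ->]; rewrite actE EA /= !mxE /=. Qed.

Lemma represents_act_infty a b c d g : represents a b c d g ->
  act g infty = if c == 0 then infty else Some (a%:~R / c%:~R : R).
Proof. by move=> [A EA ->]; rewrite actE EA /= !mxE /= intr_eq0. Qed.

(** The new denominator is [y - n] times the old one, at finite points as well as at infinity, so it
    vanishes only if [y = n]. *)
Lemma act_step n g p y : act g p = Some y -> y != n%:~R ->
  act (cf_step n g) p = Some (y - n%:~R)^-1.
Proof.
have [a [b [c [d hg]]]] := represents_ex g.
have hs := represents_step n hg.
case: p => [z|].
  rewrite (represents_act_some _ hg) (represents_act_some _ hs).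
  case: eqP => // /eqP den0 [<-] yn.
  have -> : (a - n * c)%:~R * z + (b - n * d)%:~R =
    ((a%:~R * z + b%:~R) / (c%:~R * z + d%:~R) - n%:~R) *
    (c%:~R * z + d%:~R) :> R.
    by rewrite !rmorphB !rmorphM /=; field.
  rewrite mulf_eq0 subr_eq0 (negPf yn) (negPf den0) /=; congr Some.
  by rewrite invfM mulrCA divff // mulr1.
rewrite (represents_act_infty hg) (represents_act_infty hs).
case: eqP => // /eqP c0 [<-] yn.
have cR : c%:~R != 0 :> R by rewrite intr_eq0.
have E : (a - n * c)%:~R = (a%:~R / c%:~R - n%:~R) * c%:~R :> R.
  by rewrite rmorphB rmorphM /=; field.
rewrite -(@intr_eq0 R) E mulf_eq0 subr_eq0 (negPf yn) (negPf cR) /=; congr Some.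
by rewrite invfM mulrCA divff // mulr1.
Qed.

Lemma act_unstep n g p y : act g p = Some y -> y != 0 ->
  act (cf_unstep n g) p = Some (n%:~R + y^-1).
Proof.
have [a [b [c [d hg]]]] := represents_ex g.
have hs := represents_unstep n hg.
case: p => [z|].
  rewrite (represents_act_some _ hg) (represents_act_some _ hs).
  case: eqP => // /eqP den0 [<-].
  rewrite mulf_eq0 invr_eq0 (negPf den0) orbF => num0; rewrite (negPf num0).
  by congr Some; rewrite !rmorphD !rmorphM /=; field; rewrite num0 den0.
rewrite (represents_act_infty hg) (represents_act_infty hs).
case: eqP => // /eqP c0 [<-].
rewrite mulf_eq0 invr_eq0 !intr_eq0 (negPf c0) orbF => a0; rewrite (negPf a0).
by congr Some; rewrite !rmorphD !rmorphM /=; field; rewrite !intr_eq0 a0 c0.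
Qed.

End Action.

(** * Tails, digits and the elements [cf_gamma x i.+1] *)

Section ContinuedFraction.
Variables (R : realType) (x : R).
Hypothesis hx : irrational x.

Lemma irrational_step (y : R) (n : int) :
  irrational y -> irrational (y - n%:~R)^-1.
Proof.
move=> hy [q _ qE]; apply: hy; exists (q^-1 + n%:~R) => //.
by rewrite rmorphD fmorphV /= qE invrK rmorph_int subrK.
Qed.

Lemma irrational_neq_int (y : R) (n : int) : irrational y -> y != n%:~R.
Proof.
move=> hy; apply/eqP => yn; apply: hy; exists n%:~R => //.
by rewrite yn rmorph_int.
Qed.

Lemma cf_tail_irrational i : irrational (cf_tail x i).
Proof. by elim: i => //= i IH; apply: irrational_step. Qed.

Lemma act_cf_gamma i : act (cf_gamma x i) (Some x) = Some (cf_tail x i).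
Proof.
elim: i => [|i IH].
  rewrite (represents_act_some x represents1) mul0r add0r oner_eq0.
  by rewrite mul1r addr0 divr1.
have step n := act_step IH (irrational_neq_int n (@cf_tail_irrational i)).
exact: step (cf_digit x i).
Qed.

(** The fractional part of the previous tail lies in [0, 1), and irrationality excludes 0. *)
Lemma cf_tail_gt1 i : 1 < cf_tail x i.+1.
Proof.
have := irrational_neq_int (Num.floor (cf_tail x i)) (@cf_tail_irrational i).
have /andP[] := floor_itv (cf_tail x i).
rewrite /= rmorphD /= => le lt ne.
have pos : 0 < cf_tail x i - (Num.floor (cf_tail x i))%:~R.
  by rewrite subr_gt0 lt_neqAle eq_sym ne.
by rewrite invf_gt1 //; lra.
Qed.

Lemma cf_digit_ge1 i : 1 <= cf_digit x i.+1.
Proof. by rewrite /cf_digit floor_ge_int ltW // cf_tail_gt1. Qed.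

Lemma represents_cf_gamma1 :
  represents 0 1 1 (- cf_digit x 0) (cf_gamma x 1).
Proof.
by move: (represents_step (cf_digit x 0) represents1); congr represents; ring.
Qed.

(** The determinant clauses keep these elements out of [W1] and [W2]. A step sends r to 1 / (r - n)
    with n >= 1, which lies in [-1, 0). So 0 occurs only at the start, and -1 only after r = 0 with
    n = 1, where the determinant turns from -1 to 1. *)
Lemma cf_gamma_infty i : exists r : R,
  [/\ act (cf_gamma x i.+1) infty = Some r, -1 <= r <= 0,
      r = 0 -> PGL2Z_det (cf_gamma x i.+1) = -1
    & r = -1 -> PGL2Z_det (cf_gamma x i.+1) = 1].
Proof.
elim: i => [|i [r [rE /andP[r_ge r_le] r0 _]]].
  exists 0; rewrite (represents_act_infty _ represents_cf_gamma1) mul0r.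
  split=> // [|_|]; first by rewrite lerN10 lexx.
    by rewrite -(represents_det represents_cf_gamma1); ring.
  by move/eqP; rewrite eq_sym oppr_eq0 oner_eq0.
have n1 : 1 <= (cf_digit x i.+1)%:~R :> R.
  by rewrite -[1]/(1%:~R) ler_int cf_digit_ge1.
have neg : r - (cf_digit x i.+1)%:~R < 0 by lra.
exists (r - (cf_digit x i.+1)%:~R)^-1; split.
- by apply: (act_step (n := cf_digit x i.+1)) rE _; rewrite -subr_eq0 lt_eqF.
- rewrite invr_le0 (ltW neg) andbT -[X in X <= _]invrN1.
  by rewrite lef_nV2 ?negrE ?ltrN10 //; lra.
- by move=> /eqP; rewrite invr_eq0 lt_eqF.
- move=> /(congr1 GRing.inv); rewrite invrK invrN1 => rn.
  by rewrite [PGL2Z_det _]det_step r0 ?opprK //; lra.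
Qed.

Lemma Gamma_set_W i :
  [/\ W x (cf_gamma x i.+1), ~ W1 x (cf_gamma x i.+1)
    & ~ W2 x (cf_gamma x i.+1)].
Proof.
have [r [rE r_itv r0 rN1]] := cf_gamma_infty i.
split; first by split; [exists r | exists (cf_tail x i.+1);
  [exact: act_cf_gamma | exact: cf_tail_gt1]].
- by case=> _; rewrite rE => -[/r0 ->].
- by case=> _; rewrite rE => -[/rN1 ->].
Qed.

(** * Elements sending infinity to 0 *)

Lemma represents_infty0 g : act g infty = Some (0 : R) ->
  exists n, represents 0 (- PGL2Z_det g) 1 n g.
Proof.
have [a [b [c [d hg]]]] := represents_ex g.
rewrite (represents_act_infty _ hg); case: eqP => // /eqP c0 [/eqP].
rewrite mulf_eq0 invr_eq0 !intr_eq0 (negPf c0) orbF => /eqP a0.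
rewrite a0 in hg; have detE := represents_det hg.
(* With [a = 0] the determinant is - b c, so |b| |c| = 1. *)
have [c1|cN1] : c = 1 \/ c = -1.
  have /eqP : (`|b| * `|c|)%N = 1%N.
    by rewrite -abszM; case: (PGL2Z_det_sign g) detE => ->; lia.
  by rewrite muln_eq1; lia.
- by exists d; move: hg; rewrite -detE c1; congr represents; ring.
- exists (- d); move: (representsN hg); rewrite -detE cN1.
  by congr represents; ring.
Qed.

(** Here g(y) = 1 / (y + n), so g(x) > 1 means 0 < x + n < 1, which fixes n. *)
Lemma W_infty0_cf_gamma1 g :
  W x g -> act g infty = Some (0 : R) -> PGL2Z_det g = -1 -> g = cf_gamma x 1.
Proof.
move=> [_ [s sE s1]] /represents_infty0[n] + detg; rewrite detg opprK => hg.
suff E : n = - cf_digit x 0.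
  by apply: represents_inj hg _; rewrite E; exact: represents_cf_gamma1.
rewrite /cf_digit /=.
move: sE s1; rewrite (represents_act_some _ hg); case: eqP => // _ [<-].
rewrite !mul1r mul0r add0r div1r => s1.
have pos : 0 < x + n%:~R by rewrite -invr_gt0 (lt_trans ltr01).
move: s1; rewrite invf_gt1 // => s1.
rewrite (@floor_def _ x (- n)) ?opprK //.
by rewrite rmorphD rmorphN /=; lra.
Qed.

(** Here g(y) = -1 / (y + n), so g(x) > 1 means -1 < x + n < 0, which fixes n. *)
Lemma represents_W1 g : W1 x g ->
  represents 0 (-1) 1 (- Num.floor x - 1) g.
Proof.
move=> [[_ [s sE s1]] /represents_infty0[n] + detg]; rewrite detg => hg.
suff -> : Num.floor x = - n - 1.
  by move: hg; congr represents; ring.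
move: sE s1; rewrite (represents_act_some _ hg); case: eqP => // _ [<-].
rewrite !mul1r mul0r add0r rmorphN /= mulN1r -invrN => s1.
have pos : 0 < - (x + n%:~R) by rewrite -invr_gt0 (lt_trans ltr01).
move: s1; rewrite invf_gt1 // => s1.
apply: floor_def; rewrite subrK rmorphB rmorphN /=; lra.
Qed.

(** The only candidate sends [x] to 1 / (1 - t), with t the fractional part of [x]; this exceeds 1
    because irrationality gives t > 0. *)
Lemma W1_singleton : exists g, W1 x = [set g].
Proof.
have [|g hg] := @represents_mx22 0 (-1) 1 (- Num.floor x - 1).
  by rewrite mul0r mulN1r opprK add0r.
exists g; apply/seteqP; split=> [h /represents_W1 hh|_ ->].
  exact: represents_inj hh hg.
have ginf : act g infty = Some (0 : R).
  by rewrite (represents_act_infty _ hg) mul0r.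
split=> //; last by rewrite -(represents_det hg); ring.
split; first by exists 0 => //; rewrite lerN10 lexx.
have := irrational_neq_int (Num.floor x) hx.
have /andP[] := floor_itv x; rewrite rmorphD /= => le lt ne.
have pos : 0 < - (x + (- Num.floor x - 1)%:~R).
  by rewrite rmorphB rmorphN /=; lra.
have flt : (Num.floor x)%:~R < x by rewrite lt_neqAle eq_sym ne.
have gx : act g (Some x) = Some (- (x + (- Num.floor x - 1)%:~R))^-1.
  rewrite (represents_act_some x hg) mul1r mul0r add0r.
  by rewrite -oppr_eq0 gt_eqF // rmorphN /= mulN1r -invrN.
exists (- (x + (- Num.floor x - 1)%:~R))^-1; first exact: gx.
by rewrite invf_gt1 // rmorphB rmorphN /=; lra.
Qed.

(** * Removing a digit: uniqueness in [W2] and the descent *)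

Lemma W_unstep n (r : R) g : 1 <= n -> W x g -> act g infty = Some r ->
  r != 0 -> -1 <= n%:~R + r^-1 <= 0 -> W x (cf_unstep n g).
Proof.
move=> n1 [_ [s sE s1]] rE r0 r_itv; split.
  by exists (n%:~R + r^-1) => //; apply: act_unstep.
have s0 : 0 < s by lra.
exists (n%:~R + s^-1); first by apply: act_unstep => //; rewrite gt_eqF.
have : 1 <= n%:~R :> R by rewrite -[1]/(1%:~R) ler_int.
by have : 0 < s^-1 by [rewrite invr_gt0|]; lra.
Qed.

Lemma W2_subset1 : is_subset1 (W2 x).
Proof.
have unW g : W2 x g -> W1 x (cf_unstep 1 g).
  move=> [gW gi gd].
  have r0 : (-1 : R) != 0 by rewrite oppr_eq0 oner_eq0.
  have rE : 1%:~R + (-1)^-1 = 0 :> R by rewrite invrN1 subrr.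
  split; last by rewrite det_unstep gd opprK.
    by apply: W_unstep gW gi r0 _; rewrite // rE lerN10 lexx.
  by rewrite (act_unstep _ gi r0) rE.
move=> g h /unW /represents_W1 hg /unW /represents_W1 hh.
by apply: (can_inj (cf_unstepK 1)); apply: represents_inj hg hh.
Qed.

(** The tail of index [i.+1] is n + 1 / s with s = g(x) > 1, so its floor is [n]: the removed digit
    is the true one. *)
Lemma cf_gamma_unstep n g i : W x g -> cf_unstep n g = cf_gamma x i.+1 ->
  g = cf_gamma x i.+2.
Proof.
move=> [_ [s sE s1]] gE.
have s0 : 0 < s by lra.
rewrite -[LHS](cf_unstepK n) gE; congr (cf_step _ _).
have tailE : cf_tail x i.+1 = n%:~R + s^-1.
  by have := act_unstep n sE; rewrite gt_eqF // gE act_cf_gamma => /(_ isT) [].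
rewrite /cf_digit tailE; apply/esym/floor_def.
rewrite rmorphD /= lerDl invr_ge0 (ltW s0) /= ltrD2l.
by rewrite invf_lt1.
Qed.

(* Descent on |a| + |c|: removing the digit n = c %/ |a| keeps g(oo) in [-1, 0].
   If |a| divides c, then |a| = 1 and the remainder 0 may land in W1; in that
   case the digit n = c - 1 is the right one. *)
Lemma W_Gamma_set g :
  W x g -> ~ W1 x g -> ~ W2 x g -> exists i, g = cf_gamma x i.+1.
Proof.
have [a [b [c [d hg]]]] := represents_ex g.
have [m] := ubnP (`|a| + `|c|)%N.
elim: m a b c d g hg => // m IH.
(* The entry [c] is nonzero since g(infinity) is finite, and negating the representative makes it
   positive. *)
suff pos a b c d g : 0 < c -> represents a b c d g ->
    (`|a| + `|c| < m.+1)%N -> W x g -> ~ W1 x g -> ~ W2 x g ->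
    exists i, g = cf_gamma x i.+1.
  move=> a b c d g hg lt gW; have [c0|cN] := ltP 0 c; first exact: (pos a b c d).
  apply: (pos (- a) (- b) (- c) (- d)) => //; last by lia.
    case: gW => -[r + _] _; rewrite (represents_act_infty _ hg).
    by case: eqP => //; lia.
  exact: representsN.
move=> c0 hg lt gW nW1 nW2.
have [[r rE /andP[r_ge r_le]] _] := gW.
have cR : 0 < c%:~R :> R by rewrite ltr0z.
have rac : r = a%:~R / c%:~R.
  by move: rE; rewrite (represents_act_infty _ hg) gt_eqF // => -[].
have a_le : a <= 0.
  by move: r_le; rewrite rac pmulr_lle0 ?invr_gt0 // lerz0.
have a_ge : - c <= a.
  by move: r_ge; rewrite rac ler_pdivlMr // mulN1r -rmorphN ler_int.
have detE := represents_det hg; have sgn := PGL2Z_det_sign g.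
have [a0|aN0] := eqVneq a 0.
  have r0 : r = 0 by rewrite rac a0 mul0r.
  exists 0%N; apply: W_infty0_cf_gamma1 => //; first by rewrite -r0.
  by case: sgn => // det1; case: nW1; split=> //; rewrite -r0.
have aR : a%:~R != 0 :> R by rewrite intr_eq0.
have r0 : r != 0 by rewrite rac mulf_neq0 // invr_eq0 gt_eqF.
(* These conditions on [n] let the induction hypothesis apply: the new value at infinity, (c + n a)
   / a, lies in [-1, 0] and |c| decreases. As the determinant changes sign, the last two conditions
   exclude [W1] and [W2]. *)
have main n : 1 <= n -> 0 <= c + n * a <= - a ->
    (`|(c + n * a)%R| < `|c|)%N ->
    (c + n * a = 0 -> PGL2Z_det g = 1) ->
    (c + n * a = - a -> PGL2Z_det g = -1) ->
    exists i, g = cf_gamma x i.+1.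
  move=> n1 /andP[q_ge q_le] lt_c q0 qa.
  have qE : n%:~R + r^-1 = (c + n * a)%:~R / a%:~R.
    by rewrite rac rmorphD rmorphM /=; field; rewrite aR gt_eqF.
  have a_lt0 : a%:~R < 0 :> R by rewrite ltrz0; lia.
  have uE := act_unstep n rE r0.
  have gW' : W x (cf_unstep n g).
    apply: W_unstep rE r0 _ => //; rewrite qE ler_ndivlMr // ler_ndivrMr //.
    by rewrite mul0r mulN1r -rmorphN ler_int ler0z q_ge q_le.
  have [|||i gE] := IH _ _ _ _ _ (represents_unstep n hg) _ gW'.
  - by lia.
  - move=> [_]; rewrite uE qE det_unstep => -[/eqP].
    rewrite mulf_eq0 invr_eq0 (negPf aR) orbF intr_eq0 => /eqP/q0 ->.
    by lia.
  - move=> [_]; rewrite uE qE det_unstep => -[/(canRL (divfK aR))].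
    rewrite mulN1r -rmorphN => /intr_inj/qa ->.
    by lia.
  - by exists i.+1; apply: cf_gamma_unstep gE.
have Na0 : 0 < - a by lia.
have cE := divz_eq c (- a).
have rem_ge := modz_ge0 c (lt0r_neq0 Na0).
have rem_lt := ltz_pmod c Na0.
have n1 : 1 <= (c %/ - a)%Z by rewrite lez_divRL // mul1r; lia.
have remE : c + (c %/ - a)%Z * a = (c %% - a)%Z by lia.
(* The remainder is less than [- a], so only remainder 0 with determinant -1 obstructs Euclidean
   division. *)
have [det1|detN1] := sgn.
  by apply: (main (c %/ - a)%Z) => //; rewrite remE; lia.
have [rem0|remN0] := eqVneq (c %% - a)%Z 0; last first.
  by apply: (main (c %/ - a)%Z) => //; rewrite remE; lia.
(* Since [a] divides [c], it divides the determinant a d - b c = -1. *)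
have aN1 : a = -1.
  suff : `|a|%N = 1%N by lia.
  suff : (`|a| * `|(d + (c %/ - a)%Z * b)%R|)%N = 1%N.
    by move/eqP; rewrite muln_eq1 => /andP[/eqP].
  rewrite -abszM; suff -> : a * (d + (c %/ - a)%Z * b) = -1 by [].
  have na : (c %/ - a)%Z * a = - c by lia.
  by rewrite -detN1 -detE mulrDr mulrA [a * (_ %/ _)%Z]mulrC na; ring.
have c2 : 1 < c.
  suff : c <> 1 by lia.
  by move=> c1; apply: nW2; split=> //; rewrite rE rac aN1 c1 divr1.
(* With [a = -1], this digit gives c + n a = 1 = - a, allowed for determinant -1; 1 < c yields both
   n >= 1 and the decrease. *)
by apply: (main (c - 1)) => //; lia.
Qed.

End ContinuedFraction.

Theorem theorem1 (R : realType) (x : R) (hx : irrational x) :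
  [/\ Gamma_set x = W x `\` (W1 x `|` W2 x),
      exists g : PGL2Z, W1 x = [set g]
    & is_subset1 (W2 x)].
Proof.
split; [|exact: W1_singleton|exact: W2_subset1].
apply/seteqP; split=> [g [i _ <-]|g [gW /not_orP[nW1 nW2]]].
  by have [gW nW1 nW2] := Gamma_set_W hx i; split=> // -[].
by have [i ->] := W_Gamma_set hx gW nW1 nW2; exists i.
Qed.
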